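(* For all integers $n \geq 1$ and $1 \leq k \leq n$, the hyperbolicity cone $\Lambda_+(e_k,\mathbf{1})$ of the elementary symmetric polynomial $e_k(x_1,\ldots,x_n)=\sum_{1\leq i_1<\cdots<i_k\leq n} x_{i_1}\cdots x_{i_k}$ with respect to $\mathbf{1}=(1,\ldots,1)^T$ is spectrahedral.
   Context: A homogeneous polynomial $h\in\mathbb{R}[x_1,\ldots,x_n]$ is hyperbolic with respect to $\mathbf{e}\in\mathbb{R}^n$ if $h(\mathbf{e})\neq 0$ and for every $\mathbf{x}\in\mathbb{R}^n$ the univariate polynomial $t\mapsto h(\mathbf{x}+t\mathbf{e})$ has only real zeros. The hyperbolicity cone $\Lambda_+(h,\mathbf{e})$ is the closure of the connected component of $\{\mathbf{x}\in\mathbb{R}^n: h(\mathbf{x})\neq 0\}$ containing $\mathbf{e}$. The polynomial $e_k$ is hyperbolic with respect to $\mathbf{1}$. A cone in $\mathbb{R}^n$ is spectrahedral if it is of the form $\{\mathbf{x}\in\mathbb{R}^n : \sum_{i=1}^n x_iA_i \text{ is positive semidefinite}\}$, where $A_1,\ldots,A_n$ are real symmetric $m\times m$ matrices (for some $m$) such that $\sum_{i=1}^n y_iA_i$ is positive definite for some $(y_1,\ldots,y_n)\in\mathbb{R}^n$. *)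

(* Defs.v *)
From mathcomp Require Import all_boot all_order all_algebra.
From mathcomp Require Import all_classical all_reals all_analysis.
Import numFieldNormedType.Exports.
Import Order.TTheory GRing.Theory Num.Theory.
Set Implicit Arguments. Unset Strict Implicit. Unset Printing Implicit Defensive.
Local Open Scope classical_set_scope.
Local Open Scope ring_scope.

(* Points of R^n are row vectors 'rV[R]_n (product = Euclidean topology). *)

Definition elem_sym {R : realType} {n : nat} (k : nat) (x : 'rV[R]_n) : R :=
  \sum_(S : {set 'I_n} | #|S| == k) \prod_(i in S) x ord0 i.

Definition hyperbolicity_cone {R : realType} {n : nat}
    (h : 'rV[R]_n -> R) (e : 'rV[R]_n) : set 'rV[R]_n :=
  closure (connected_component [set x | h x != 0] e).

Definition symmetric_mx {R : realType} {m : nat} (M : 'M[R]_m) : Prop :=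
  M^T = M.
Definition psd_mx {R : realType} {m : nat} (M : 'M[R]_m) : Prop :=
  symmetric_mx M /\ forall v : 'cV[R]_m, 0 <= (v^T *m M *m v) ord0 ord0.
Definition pd_mx {R : realType} {m : nat} (M : 'M[R]_m) : Prop :=
  symmetric_mx M /\
  forall v : 'cV[R]_m, v != 0 -> 0 < (v^T *m M *m v) ord0 ord0.

Definition spectrahedral {R : realType} {n : nat} (K : set 'rV[R]_n) : Prop :=
  exists (m : nat) (A : 'I_n -> 'M[R]_m),
    (forall i, symmetric_mx (A i)) /\
    (exists y : 'rV[R]_n, pd_mx (\sum_i y ord0 i *: A i)) /\
    K = [set x | psd_mx (\sum_i x ord0 i *: A i)].

(* Main.v *)
Require Import Defs.
From mathcomp Require Import all_boot all_order all_algebra.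
From mathcomp Require Import ring lra.
Import Order.TTheory GRing.Theory Num.Theory.
Set Implicit Arguments. Unset Strict Implicit. Unset Printing Implicit Defensive.
Local Open Scope ring_scope.

(** View the real numbers [x_i] as conductances on the tree whose nodes are the
    words of length at most [k] in distinct letters, the edge from [p] to [p i]
    carrying a positive multiple of [x_i], and ground all words of length [k].
    Its Dirichlet energy is a quadratic form depending linearly on [x].  From
    [j e_j = sum_i x_i e_(j-1)(x without x_i)] the effective conductance
    between the root and the ground is [e_k / e_(k-1)] up to a factor, and
    similarly for the subtrees.  So the energy is positive semidefinite as soon
    as all [e_(k-|T|)(x without T)] are positive, and conversely, plugging
    equilibrium potentials into a positive definite energy gives [e_k > 0].

    The region [U] where all [e_(k-|T|)(x without T)] are positive is open, and
    it is closed in [e_k <> 0] because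
    [j e_j = e_1 e_(j-1) - sum_i x_i^2 e_(j-2)(x without x_i)]; hence the
    component of [1] is contained in [U].  Conversely, the points with positive
    definite energy form a convex set containing [1] on which [e_k > 0], so
    they lie in the component of [1]; and [x + eps 1] is such a point whenever
    the energy at [x] is positive semidefinite. *)

Lemma finset_ind (T : finType) (P : {set T} -> Prop) :
  P set0 -> (forall i (A : {set T}), i \notin A -> P A -> P (i |: A)) ->
  forall A : {set T}, P A.
Proof.
move=> P0 PU A; have [m] := ubnP #|A|; elim: m A => // m IH A Am.
have [->//|[i iA]] := set_0Vmem A.
rewrite -(setD1K iA); apply: PU; first by rewrite !inE eqxx.
by apply: IH; rewrite (cardsD1 i) iA in Am.
Qed.

(** * Identities and positivity for elementary symmetric polynomials *)

Section ElementarySymmetric.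
Variables (R : realFieldType) (I : finType) (x : I -> R).
Implicit Types (S : {set I}) (i : I).

(** Taking coefficients of this generating polynomial turns the deletion of a variable into removing
    a factor, and Euler's identity into a derivative. *)
Definition esp_gen S : {poly R} := \prod_(i in S) (1 + x i *: 'X).

Definition esp S (j : nat) : R := (esp_gen S)`_j.

Lemma esp_geneD1 S i : i \in S ->
  esp_gen S = (1 + x i *: 'X) * esp_gen (S :\ i).
Proof.
move=> iS; rewrite /esp_gen (bigD1 i) //=; congr (_ * _).
by apply: eq_bigl => l; rewrite !inE andbC.
Qed.

Lemma esp0 S : esp S 0 = 1.
Proof.
rewrite /esp coef0_prod big1 // => i _.
by rewrite coefD coef1 coefZ coefX mulr0 addr0.
Qed.

Lemma espD1 S i j : i \in S ->
  esp S j.+1 = esp (S :\ i) j.+1 + x i * esp (S :\ i) j.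
Proof.
move=> iS; rewrite /esp (esp_geneD1 iS) mulrDl mul1r -scalerAl mulrC.
by rewrite coefD coefZ mulrC coefXM.
Qed.

Lemma deriv_prod_set (A : {set I}) (F : I -> {poly R}) :
  (\prod_(i in A) F i)^`()
  = \sum_(i in A) (F i)^`() * \prod_(l in A :\ i) F l.
Proof.
elim/(@finset_ind I): A => [|i A iA IH].
  by rewrite !big_set0 derivC.
rewrite !big_setU1 //= derivM IH setU1K //; congr (_ + _).
rewrite big_distrr /=; apply: eq_bigr => l lA.
have il : i != l by apply: contraNneq iA => ->.
have -> : (i |: A) :\ l = i |: (A :\ l).
  apply/setP => z; rewrite !inE; case: (eqVneq z l) => // ->.
  by rewrite eq_sym (negPf il).
by rewrite big_setU1 ?inE ?negb_and ?iA ?orbT //= mulrCA.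
Qed.

(** Compare the coefficients of degree [j] in the derivative of the generating polynomial, expanded
    by the product rule. *)
Lemma sum_espD1M S j :
  \sum_(i in S) x i * esp (S :\ i) j = j.+1%:R * esp S j.+1.
Proof.
rewrite mulr_natl /esp -coef_deriv deriv_prod_set coef_sum.
apply: eq_bigr => i _.
by rewrite derivD derivC add0r derivZ derivX -scalerAl mul1r coefZ.
Qed.

Lemma esp1 S : esp S 1 = \sum_(i in S) x i.
Proof.
have := sum_espD1M S 0; rewrite mul1r => <-.
by apply: eq_bigr => i _; rewrite esp0 mulr1.
Qed.

(** A monomial of degree [j] survives the deletion of each of the [#|S| - j] indices outside it. *)
Lemma sum_espD1 S j :
  \sum_(i in S) esp (S :\ i) j = (#|S|%:R - j%:R) * esp S j.
Proof.
case: j => [|j].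
  rewrite esp0 (eq_bigr (fun=> 1)) => [|i _]; last exact: esp0.
  by rewrite sumr_const subr0 mulr1.
rewrite mulrBl -sum_espD1M (mulr_natl (esp S j.+1)) -sumr_const -sumrB.
by apply: eq_bigr => i iS; rewrite (espD1 _ iS) addrK.
Qed.

(** Substitute [esp (S :\ i) j.+1 = esp S j.+1 - x i * esp (S :\ i) j] in Euler's identity. *)
Lemma espSS S j :
  j.+2%:R * esp S j.+2 =
  esp S 1 * esp S j.+1 - \sum_(i in S) x i ^+ 2 * esp (S :\ i) j.
Proof.
rewrite -sum_espD1M.
rewrite esp1 big_distrl /= -sumrB; apply: eq_bigr => i iS.
rewrite (espD1 _ iS); ring.
Qed.

Lemma espT j :
  esp [set: I] j = \sum_(T : {set I} | #|T| == j) \prod_(i in T) x i.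
Proof.
rewrite /esp /esp_gen (eq_bigr (fun i => x i *: 'X + 1)) => [|i _];
  last by rewrite addrC.
rewrite (eq_bigl xpredT) => [|i]; last by rewrite inE.
rewrite bigA_distr coef_sum [RHS]big_mkcond; apply: eq_bigr => T _.
rewrite -big_mkcond /= scaler_prod prodr_const coefZ coefXn eq_sym.
by case: eqP; rewrite ?mulr1 ?mulr0.
Qed.

(* The predicate [P] holds of [esp (S :\: T) (j - #|T|)] for all [T]
   contained in [S] with fewer than [j] elements. *)
Fixpoint esp_all (P : R -> Prop) (j : nat) S : Prop :=
  if j is l.+1 then
    P (esp S j) /\ forall i, i \in S -> esp_all P l (S :\ i)
  else True.

Lemma esp_all_ge0 j S : esp_all (fun a => 0 < a) j S ->
  esp_all (fun a => 0 <= a) j S.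
Proof.
elim: j S => //= j IH S [/ltW ge0 all_gt0]; split=> // i iS.
exact/IH/all_gt0.
Qed.

(* The open region is relatively closed in the non-vanishing locus. *)
Lemma esp_all_gt0 j S : esp_all (fun a => 0 <= a) j S -> esp S j != 0 ->
  esp_all (fun a => 0 < a) j S.
Proof.
elim: j S => //= j IH S [ge0 all_ge0] neq0.
have gt0 : 0 < esp S j.+1 by rewrite lt_def neq0.
split=> // i iS; apply: IH; first exact: all_ge0.
have := all_ge0 i iS; case: j {ge0 all_ge0 neq0} gt0 => [|j] gt0.
  by rewrite esp0 oner_eq0.
(* If [esp (S :\ i) j.+1] vanished, [esp S j.+2] would equal [esp (S :\ i) j.+2], which [espSS]
   makes nonpositive. *)
move=> [ge0 all_ge0]; apply/eqP => eq0.
move: gt0; rewrite (espD1 _ iS) eq0 mulr0 addr0.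
apply/negP; rewrite -leNgt -(pmulr_rle0 _ (ltr0Sn R j.+1)) espSS eq0 mulr0.
rewrite sub0r oppr_le0 sumr_ge0 // => l lS.
rewrite mulr_ge0 ?sqr_ge0 //; case: j all_ge0 {eq0 ge0} => [|j] all_ge0.
  by rewrite esp0 ler01.
by have [] := all_ge0 l lS.
Qed.

(** The hypothesis controls degree [j] only after a deletion; averaging over all deletions recovers
    it on [S] itself. *)
Lemma esp_all_pred j S : esp_all (fun a => 0 < a) j.+1 S -> (j < #|S|)%N ->
  0 < esp S j.
Proof.
case: j => [|j] [_ gt0] jS; first by rewrite esp0 ltr01.
have jS0 : (0 : R) < #|S|%:R - j.+1%:R by rewrite subr_gt0 ltr_nat.
rewrite -(pmulr_rgt0 _ jS0) -sum_espD1.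
have /card_gt0P[i iS] : (0 < #|S|)%N by apply: leq_trans jS.
rewrite (bigD1 i) //= ltr_pwDl //; first by have [] := gt0 i iS.
by apply: sumr_ge0 => l /andP[lS _]; have [/ltW] := gt0 l lS.
Qed.

End ElementarySymmetric.

Lemma esp_cst1 (R : realFieldType) (I : finType) (S : {set I}) j :
  esp (fun=> 1 : R) S j = 'C(#|S|, j)%:R.
Proof.
elim/(@finset_ind I): S j => [|i S iS IH] [|j]; rewrite ?esp0 ?bin0 //.
  by rewrite /esp /esp_gen big_set0 coef1 cards0 bin0n.
by rewrite (espD1 _ _ (setU11 i S)) setU1K // !IH mul1r -natrD cardsU1 iS.
Qed.

Lemma esp_all_cst1 (R : realFieldType) (I : finType) (S : {set I}) j :
  (j <= #|S|)%N -> esp_all (fun=> 1 : R) (fun a => 0 < a) j S.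
Proof.
elim: j S => //= j IH S jS; split=> [|i iS].
  by rewrite esp_cst1 ltr0n bin_gt0.
by apply: IH; rewrite (cardsD1 i) iS in jS.
Qed.

(** * The Dirichlet energy of the tree *)

Section TreeEnergy.
Variables (R : realFieldType) (I : finType).
Implicit Types (x y : I -> R) (S : {set I}) (i : I) (V : seq I -> R) (j : nat).

(* Dirichlet energy of the potential [V] on the rooted tree whose nodes are the
   words of length at most [j] in distinct letters of [S]: the edge from [p] to
   [rcons p i] has conductance proportional to [x i], and all words of length
   [j] are grounded. *)
Fixpoint energy x j S V : R :=
  if j is l.+1 then
    \sum_(i in S) (l`!%:R * x i * (V [::] - (0 < l)%N%:R * V [:: i]) ^+ 2
                   + energy x l (S :\ i) (fun p => V (i :: p)))
  else 0.

Lemma energyS x j S V : energy x j.+1 S V =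
  \sum_(i in S) (j`!%:R * x i * (V [::] - (0 < j)%N%:R * V [:: i]) ^+ 2
                 + energy x j (S :\ i) (fun p => V (i :: p))).
Proof. by []. Qed.

(** Only the ungrounded nodes, of length less than [j], are listed: the energy depends on no other
    values. *)
Fixpoint tree_nodes j S : seq (seq I) :=
  if j is l.+1 then
    [::] :: flatten
      [seq [seq i :: p | p <- tree_nodes l (S :\ i)] | i <- enum S]
  else [::].

Lemma nil_tree_nodes j S : [::] \in tree_nodes j.+1 S.
Proof. exact: mem_head. Qed.

Lemma cons_tree_nodes j S i p :
  (i :: p \in tree_nodes j.+1 S) = (i \in S) && (p \in tree_nodes j (S :\ i)).
Proof.
rewrite /= inE /=; apply/flatten_mapP/andP => [[l]|[iS pS]].
  by rewrite mem_enum => lS /mapP[q qS [-> ->]].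
by exists i; rewrite ?mem_enum // map_f.
Qed.

Lemma eq_energy x j S V W : {in tree_nodes j S, V =1 W} ->
  energy x j S V = energy x j S W.
Proof.
elim: j S V W => //= j IH S V W VW; apply: eq_bigr => i iS.
rewrite (IH _ _ (fun p => W (i :: p))) => [|p pS]; last first.
  by rewrite VW // (cons_tree_nodes j) iS.
congr (_ * _ ^+ 2 + _); rewrite (VW [::]) ?nil_tree_nodes //.
case: j VW {IH} => [|j] VW; rewrite ?mul0r // VW //.
by rewrite (cons_tree_nodes j.+1) iS.
Qed.

Lemma energy_cst0 x j S : energy x j S (fun=> 0) = 0.
Proof.
elim: j S => //= j IH S; rewrite big1 // => i _.
by rewrite IH mulr0 subr0 expr0n mulr0 addr0.
Qed.

Lemma energy_comb x y (a b : R) j S V :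
  energy (fun i => a * x i + b * y i) j S V
    = a * energy x j S V + b * energy y j S V.
Proof.
elim: j S V => [|j IH] S V; first by rewrite /energy !mulr0 addr0.
rewrite !energyS !mulr_sumr -big_split; apply: eq_bigr => i _ /=.
by rewrite IH; ring.
Qed.

Lemma energyZ x j S (c : R) V :
  energy x j S (fun p => c * V p) = c ^+ 2 * energy x j S V.
Proof.
elim: j S V => [|j IH] S V /=; first by rewrite mulr0.
rewrite big_distrr /=; apply: eq_bigr => i _.
by rewrite (IH _ (fun p => V (i :: p))); ring.
Qed.

Arguments energy : simpl never.

(* The coefficient [esp S j.+1 / esp S j] is, up to a factorial, the effective
   conductance between the root and the ground. *)
Lemma energy_ge x j S V : esp_all x (fun a => 0 < a) j.+1 S -> (j < #|S|)%N ->
  j.+1`!%:R * (esp x S j.+1 / esp x S j) * V [::] ^+ 2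
    <= energy x j.+1 S V.
Proof.
elim: j S V => [|j IH] S V Sgt0 jS.
  rewrite esp0 divr1 mul1r esp1 energyS /= big_distrl.
  apply: ler_sum => i _ /=.
  by rewrite mul0r subr0 [energy _ _ _ _]/energy addr0 mul1r.
have ej0 := esp_all_pred Sgt0 jS.
(* Euler's identity splits the root conductance into one summand per branch, to be compared with the
   energy of that branch. *)
rewrite factS natrM (mulrC j.+2%:R) -(mulrA _ j.+2%:R) [j.+2%:R * _]mulrA.
rewrite -sum_espD1M big_distrl /= big_distrr /= big_distrl energyS /=.
apply: ler_sum => i iS.
have jSi : (j < #|S :\ i|)%N by move: jS; rewrite (cardsD1 i) iS.
have Sigt0 : esp_all x (fun a => 0 < a) j.+1 (S :\ i) by case: Sgt0 => _; apply.
apply: (le_trans _ (lerD (lexx _) (IH _ (fun p => V (i :: p)) Sigt0 jSi))).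
have := esp_all_pred Sigt0 jSi.
have : 0 < esp x (S :\ i) j.+1 by case: Sigt0.
move: ej0; rewrite (espD1 x j iS) mul1r.
move: (esp _ _ j.+1) (esp _ _ j) (V [::]) (V [:: i]) (x i) => q r a b c.
move=> s0 q0 r0; rewrite -!mulrA -mulrDr ler_wpM2l ?ler0n //.
rewrite -subr_ge0.
(* Series law for the conductances [c] and [q / r]: the excess energy is a square, zero exactly when
   [b] is the equilibrium value. *)
rewrite [X in 0 <= X](_ : _
  = (c * r * a - (q + c * r) * b) ^+ 2 / ((q + c * r) * r)); last first.
  by field; rewrite !gt_eqF.
by rewrite divr_ge0 ?sqr_ge0 // mulr_ge0 ?ltW.
Qed.

Lemma energy_ge0 x j S V : esp_all x (fun a => 0 < a) j S -> (j <= #|S|)%N ->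
  0 <= energy x j S V.
Proof.
case: j => //= j Sgt0 jS; apply: (le_trans _ (energy_ge V Sgt0 jS)).
rewrite mulr_ge0 ?sqr_ge0 // mulr_ge0 // divr_ge0 ?ltW //; first by case: Sgt0.
exact: esp_all_pred.
Qed.

(* The equilibrium potential of the tree, with denominators cleared. *)
Fixpoint potential x j S (p : seq I) : R :=
  if p is i :: q then x i * potential x j.-1 (S :\ i) q else esp x S j.

(** The potential drops by [esp x (S :\ i) j] along the edge from the root to [i], and below that
    edge it is [x i] times the potential of the smaller tree. *)
Lemma energy_potential x j S :
  energy x j.+1 S (potential x j S) = j.+1`!%:R * esp x S j.+1 * esp x S j.
Proof.
elim: j S => [|j IH] S.
  rewrite esp0 mulr1 mul1r esp1 energyS /=.
  by apply: eq_bigr => i _; rewrite !esp0 fact0 /energy; ring.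
rewrite factS natrM (mulrC j.+2%:R) -(mulrA _ j.+2%:R) -sum_espD1M.
rewrite big_distrr /= big_distrl energyS /=.
apply: eq_bigr => i iS; rewrite /= energyZ IH (espD1 x j iS) mul1r; ring.
Qed.

(* [c] is the label of the edge joining the tree to its parent. *)
Lemma esp_gt0_of_energy x j S c : (j < #|S|)%N ->
  (forall V, has (fun p => V p != 0) (tree_nodes j.+1 S) ->
     0 < j.+1`!%:R * c * V [::] ^+ 2 + energy x j.+1 S V) ->
  0 < esp x S j.+1 + c * esp x S j.
Proof.
elim: j S c => [|j IH] S c jS Vgt0.
  have := Vgt0 (potential x 0 S); rewrite energy_potential /= esp0 oner_neq0.
  by move=> /(_ isT); rewrite !mul1r expr1n !mulr1 addrC.
have ej0 : 0 < esp x S j.+1.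
  have /card_gt0P[i iS] : (0 < #|S|)%N by apply: leq_trans jS.
  rewrite (espD1 x j iS); apply: IH => [|V /hasP[p pS Vp]].
    by move: jS; rewrite (cardsD1 i) iS.
  (* Extend [V] by zero to the root and the other branches: the edge to [i] then contributes the
     parent term with label [x i]. *)
  pose W p := if p is l :: q then (l == i)%:R * V q else 0.
  have := Vgt0 W; rewrite [W [::]]/= expr0n mulr0 add0r.
  have -> : has (fun p => W p != 0) (tree_nodes j.+2 S).
    apply/hasP; exists (i :: p); first by rewrite cons_tree_nodes iS.
    by rewrite /= eqxx mul1r.
  move=> /(_ isT); rewrite energyS (bigD1 i) //= big1 ?addr0 => [|l /andP[_ /negPf li]];
    last first.
    rewrite li !mul0r mulr0 subr0 expr0n mulr0 add0r.
    rewrite (@eq_energy _ _ _ _ (fun=> 0)) ?(energy_cst0 x j.+1) // => p' _.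
    by rewrite mul0r.
  rewrite eqxx !mul1r sub0r sqrrN.
  rewrite (@eq_energy _ j.+1 _ _ V) // => p' _.
  by rewrite mul1r.
(* The equilibrium potential is an admissible test since its root value [esp x S j.+1] is
   nonzero. *)
have := Vgt0 (potential x j.+1 S); rewrite energy_potential /= gt_eqF //.
move=> /(_ isT); rewrite [X in 0 < X](_ : _ =
  j.+2`!%:R * esp x S j.+1 * (esp x S j.+2 + c * esp x S j.+1)); last ring.
by rewrite pmulr_rgt0 // mulr_gt0 // ltr0n fact_gt0.
Qed.

Lemma energy_cst1_ge0 j S V : 0 <= energy (fun=> 1) j S V.
Proof.
elim: j S V => [|j IH] S V; first exact: lexx.
rewrite energyS; apply: sumr_ge0 => i iS.
by rewrite addr_ge0 // mulr1 mulr_ge0 ?sqr_ge0.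
Qed.

(** With unit conductances zero energy forbids any drop along an edge, and [j <= #|S|] lets every
    node be continued down to the ground. *)
Lemma energy_cst1_eq0 j S V : (j <= #|S|)%N -> energy (fun=> 1) j S V = 0 ->
  {in tree_nodes j S, forall p, V p = 0}.
Proof.
elim: j S V => // j IH S V jS; rewrite energyS.
have ge0 i : 0 <= j`!%:R * 1 * (V [::] - (0 < j)%N%:R * V [:: i]) ^+ 2.
  by rewrite mulr1 mulr_ge0 ?sqr_ge0.
move/eqP; rewrite psumr_eq0 => [|i _];
  last by rewrite addr_ge0 ?energy_cst1_ge0.
move=> /allP eq0.
have {eq0} E i : i \in S -> V [::] = (0 < j)%N%:R * V [:: i] /\
    energy (fun=> 1) j (S :\ i) (fun p => V (i :: p)) = 0.
  move=> iS; have := eq0 i (mem_index_enum i); rewrite iS /=.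
  rewrite paddr_eq0 ?energy_cst1_ge0 // => /andP[+ /eqP ->].
  rewrite mulr1 mulf_eq0 sqrf_eq0 subr_eq0 pnatr_eq0.
  by rewrite (gtn_eqF (fact_gt0 j)) /= => /eqP.
have V0 i p : i \in S -> p \in tree_nodes j (S :\ i) -> V (i :: p) = 0.
  move=> iS; have [_ E0] := E i iS.
  apply: (IH (S :\ i) (fun p => V (i :: p))) => //.
  by move: jS; rewrite (cardsD1 i) iS.
case=> [_|i p]; last by rewrite (cons_tree_nodes j) => /andP[]; apply: V0.
have /card_gt0P[i iS] : (0 < #|S|)%N by apply: leq_trans jS.
have [-> _] := E i iS.
case: j {IH jS ge0 E} V0 => [|j] V0; first by rewrite mul0r.
by rewrite V0 ?mulr0 // nil_tree_nodes.
Qed.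

End TreeEnergy.

From mathcomp Require Import all_classical all_reals all_analysis.
Import numFieldNormedType.Exports.

(** * Matrices representing the energy *)

Section EnergyMatrix.
Variables (R : realType) (n m : nat).
Implicit Types (S : {set 'I_n}) (d : seq 'I_n -> 'cV[R]_m) (j : nat).

(** The column [d p] represents the linear form giving the potential at [p]; each edge labelled [l]
    contributes a rank-one matrix. *)
Fixpoint energy_mx j S d (l : 'I_n) : 'M[R]_m :=
  if j is h.+1 then
    \sum_(i in S)
      (let b := d [::] - (0 < h)%N%:R *: d [:: i] in
       (h`!%:R * (i == l)%:R) *: (b *m b^T)
       + energy_mx h (S :\ i) (fun p => d (i :: p)) l)
  else 0.

Lemma energy_mx_sym j S d l : symmetric_mx (energy_mx j S d l).
Proof.
rewrite /symmetric_mx; elim: j S d => [|j IH] S d /=; first by rewrite trmx0.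
rewrite linear_sum; apply: eq_bigr => i _ /=.
by rewrite linearD linearZ /= IH trmx_mul trmxK.
Qed.

Definition node_value d (v : 'cV[R]_m) p : R := (v^T *m d p) ord0 ord0.

Lemma energy_mxE j S d (x : 'rV[R]_n) (v : 'cV[R]_m) :
  (v^T *m (\sum_l x ord0 l *: energy_mx j S d l) *m v) ord0 ord0
  = energy (x ord0) j S (node_value d v).
Proof.
elim: j S d => [|j IH] S d.
  by rewrite big1 ?mulmx0 ?mul0mx ?mxE // => l _; rewrite scaler0.
rewrite energyS.
have -> : \sum_l x ord0 l *: energy_mx j.+1 S d l = \sum_(i in S)
    ((j`!%:R * x ord0 i) *: ((d [::] - (0 < j)%N%:R *: d [:: i])
        *m (d [::] - (0 < j)%N%:R *: d [:: i])^T)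
     + \sum_l x ord0 l *: energy_mx j (S :\ i) (fun p => d (i :: p)) l).
  under eq_bigr do rewrite /= scaler_sumr.
  rewrite exchange_big /=; apply: eq_bigr => i _.
  under eq_bigr do rewrite scalerDr scalerA.
  rewrite big_split /= -scaler_suml (bigD1 i) //= eqxx big1 => [|l /negPf].
    by rewrite addr0 mulr1 mulrC.
  by rewrite eq_sym => ->; rewrite !mulr0.
rewrite mulmx_sumr mulmx_suml summxE; apply: eq_bigr => i _.
rewrite mulmxDr mulmxDl mxE IH; congr (_ + _).
rewrite -scalemxAr -scalemxAl mxE; congr (_ * _).
set b := d [::] - _.
have -> : v^T *m (b *m b^T) *m v = (v^T *m b) *m (v^T *m b)^T.
  by rewrite trmx_mul trmxK !mulmxA.
rewrite mxE big_ord1 [in X in _ * X]mxE -expr2; congr (_ ^+ 2).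
by rewrite /b /node_value mulmxBr -scalemxAr !mxE.
Qed.

End EnergyMatrix.

(** * The matrix pencil of the full tree *)

Section TreePencil.
Variables (R : realType) (n j : nat).

(** [undup] makes the numbering of nodes injective, so that [node] sends listed words to distinct
    basis vectors and grounded words to 0. *)
Let L : seq (seq 'I_n) := undup (tree_nodes j [set: 'I_n]).

Let m := size L.

Let node (p : seq 'I_n) : 'cV[R]_m := \col_(i < m) (nth [::] L i == p)%:R.

Definition tree_mx (l : 'I_n) : 'M[R]_m := energy_mx j [set: 'I_n] node l.

Lemma node_value_nth v (i : 'I_m) : node_value node v (nth [::] L i) = v i ord0.
Proof.
rewrite /node_value mxE (bigD1 i) //= !mxE eqxx mulr1 big1 ?addr0 // => l li.
by rewrite !mxE nth_uniq ?undup_uniq // (inj_eq val_inj) (negPf li) mulr0.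
Qed.

Lemma tree_nodesP p :
  reflect (exists i : 'I_m, nth [::] L i = p) (p \in tree_nodes j [set: 'I_n]).
Proof.
rewrite -mem_undup; apply: (iffP (nthP [::])) => [[i im <-]|[i <-]].
  by exists (Ordinal im).
by exists i.
Qed.

Lemma tree_pencil_sym (x : 'rV[R]_n) :
  symmetric_mx (\sum_l x ord0 l *: tree_mx l).
Proof.
rewrite /symmetric_mx linear_sum; apply: eq_bigr => l _ /=.
by rewrite linearZ /= energy_mx_sym.
Qed.

Lemma psd_tree_pencil (x : 'rV[R]_n) :
  psd_mx (\sum_l x ord0 l *: tree_mx l) <->
  forall V, 0 <= energy (x ord0) j [set: 'I_n] V.
Proof.
split=> [[_ psd] V|E0]; last first.
  by split=> [|v]; [exact: tree_pencil_sym|rewrite energy_mxE].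
have := psd (\col_i V (nth [::] L i)); rewrite energy_mxE.
rewrite (@eq_energy _ _ _ _ _ _ V) // => _ /tree_nodesP[i <-].
by rewrite node_value_nth mxE.
Qed.

Lemma pd_tree_pencil (x : 'rV[R]_n) :
  pd_mx (\sum_l x ord0 l *: tree_mx l) <->
  forall V, has (fun p => V p != 0) (tree_nodes j [set: 'I_n]) ->
    0 < energy (x ord0) j [set: 'I_n] V.
Proof.
split=> [[_ pd] V /hasP[p /tree_nodesP[i <-] Vi0]|E0].
  have := pd (\col_i V (nth [::] L i)); rewrite energy_mxE.
  rewrite (@eq_energy _ _ _ _ _ _ V) => [->//|_ /tree_nodesP[l <-]].
    by apply: contraNneq Vi0 => /matrixP/(_ i ord0); rewrite !mxE => ->.
  by rewrite node_value_nth mxE.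
split=> [|v v0]; first exact: tree_pencil_sym.
rewrite energy_mxE; apply: E0; apply: contraNT v0 => /hasPn V0.
apply/eqP/colP => i; rewrite -node_value_nth [RHS]mxE; apply/eqP.
by have /V0 : nth [::] L i \in tree_nodes j [set: 'I_n];
  [apply/tree_nodesP; exists i|rewrite negbK].
Qed.

End TreePencil.

(** * Continuity, and open and closed positivity regions *)

Section Topology.
Variables (R : realType) (n : nat).
Implicit Types (x y : 'rV[R]_n) (S : {set 'I_n}).

Lemma esp_continuous j S : continuous (fun x => esp (x ord0) S j).
Proof.
elim/(@finset_ind 'I_n): S j => [|i S iS IH] [|j] x.
- by under eq_fun do rewrite esp0; exact: cst_continuous.
- under eq_fun do rewrite /esp /esp_gen finset.big_set0.
  exact: cst_continuous.
- by under eq_fun do rewrite esp0; exact: cst_continuous.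
under eq_fun do rewrite (espD1 _ _ (finset.setU11 i S)) setU1K //.
apply: (@cvgD _ _ _ (nbhs x)); first exact: IH.
by apply: (@cvgM _ _ (nbhs x)); [exact: coord_continuous|exact: IH].
Qed.

Lemma energy_continuous j S V : continuous (fun x => energy (x ord0) j S V).
Proof.
elim: j S V => [|j IH] S V; first exact: cst_continuous.
under eq_fun do rewrite energyS.
apply: continuous_big => [|i _ x]; first exact: add_continuous.
apply: (@cvgD _ _ _ (nbhs x)); last exact: IH.
apply: (@cvgM _ _ (nbhs x)); last exact: cvg_cst.
by apply: (@cvgM _ _ (nbhs x)); [exact: cvg_cst|exact: coord_continuous].
Qed.

Lemma open_esp_all j S :
  open [set x : 'rV[R]_n | esp_all (x ord0) (fun a => 0 < a) j S]%classic.
Proof.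
rewrite openE => x /=.
rewrite /interior /=; elim: j S => [|j IH] S /=.
  by move=> _; exact: filterT.
move=> [gt0 all_gt0]; apply: filterI.
  by have /cvgr_gt/(_ _ gt0) := @esp_continuous j.+1 S x.
apply: (@filter_forall _ _ (fun i y => i \in S -> esp_all (y ord0) _ j (S :\ i))
  (nbhs x)) => i; case: (boolP (i \in S)) => iS.
  by apply: filterS (IH _ (all_gt0 i iS)).
exact: nearW.
Qed.

Lemma closed_esp_all j S :
  closed [set x : 'rV[R]_n | esp_all (x ord0) (fun a => 0 <= a) j S]%classic.
Proof.
elim: j S => [|j IH] S; first exact: closedT.
apply: closedI.
  by have /continuous_closedP/(_ _ (@closed_ge R 0)) := @esp_continuous j.+1 S.
rewrite [X in closed X](_ : _ = \bigcap_(i in [set i | i \in S])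
  [set x : 'rV[R]_n | esp_all (x ord0) (fun a => 0 <= a) j
                        (finset.setD S (finset.set1 i))])%classic.
  by apply: closed_bigI => i _; exact: IH.
by [].
Qed.

End Topology.

(** * The cone as the set of nonnegative energy *)

Section HyperbolicityCone.
Variables (R : realType) (n j : nat).
Hypothesis jn : (j < n)%N.
Implicit Types x y : 'rV[R]_n.

Let one : 'rV[R]_n := const_mx 1.

Let Etot x := energy (x ord0) j.+1 [set: 'I_n].

Let C :=
  connected_component [set x : 'rV[R]_n | elem_sym j.+1 x != 0]%classic one.

Lemma elem_sym_esp x : elem_sym j.+1 x = esp (x ord0) [set: 'I_n] j.+1.
Proof. by rewrite espT. Qed.

Lemma one_ord0 : one ord0 = fun=> 1.
Proof. by apply/funext => i; rewrite mxE. Qed.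

Lemma esp_all_one : esp_all (one ord0) (fun a => 0 < a) j.+1 [set: 'I_n].
Proof. by rewrite one_ord0; apply: esp_all_cst1; rewrite cardsT card_ord. Qed.

Lemma elem_sym_one : elem_sym j.+1 one != 0.
Proof. by rewrite elem_sym_esp; have [/lt0r_neq0] := esp_all_one. Qed.

Lemma component_esp_all :
  (C `<=` [set x : 'rV[R]_n |
             esp_all (x ord0) (fun a => 0 < a) j.+1 finset.setT])%classic.
Proof.
set U := (X in (_ `<=` X)%classic).
have CU : (C `&` U = C)%classic; last by rewrite -CU; exact: subIsetr.
apply: (@component_connected _
  [set x : 'rV[R]_n | elem_sym j.+1 x != 0]%classic one).
- exists one; split; last exact: esp_all_one.
  exact/connected_component_refl/elem_sym_one.
- by exists U => //; exact: open_esp_all.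
(* Weak and strict inequalities cut out the same part of [C], where [elem_sym] does not vanish, so
   this part is clopen in [C]. *)
exists [set x : 'rV[R]_n |
          esp_all (x ord0) (fun a => 0 <= a) j.+1 finset.setT]%classic.
  exact: closed_esp_all.
apply/seteqP; split=> x [Cx Ux]; split=> //; first exact: esp_all_ge0.
apply: esp_all_gt0 Ux _; rewrite -elem_sym_esp.
exact: (connected_component_sub Cx).
Qed.

Lemma energy_one_gt0 V :
  has (fun p => V p != 0) (tree_nodes j.+1 [set: 'I_n]) ->
  0 < Etot one V.
Proof.
move=> /hasP[p pT Vp]; rewrite /Etot one_ord0 lt_def energy_cst1_ge0 andbT.
apply: contraNneq Vp => /energy_cst1_eq0 -> //.
by rewrite cardsT card_ord.
Qed.

Lemma elem_sym_gt0 x :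
  (forall V, has (fun p => V p != 0) (tree_nodes j.+1 [set: 'I_n]) ->
    0 < Etot x V) -> 0 < elem_sym j.+1 x.
Proof.
move=> Egt0; rewrite elem_sym_esp -[esp _ _ _]addr0.
(* The root of the full tree has no parent edge, hence label 0. *)
rewrite -[X in _ + X](mul0r (esp (x ord0) [set: 'I_n] j)).
apply: esp_gt0_of_energy => [|V V0]; first by rewrite cardsT card_ord.
by rewrite mulr0 mul0r add0r; exact: Egt0.
Qed.

Lemma shift_in_component x e :
  (forall V, 0 <= Etot x V) -> 0 < e -> C (x + e *: one).
Proof.
move=> Ege0 e0.
(* The segment from [one] to [x + e *: one], written so that on [[0, 1]] the weight of [one] is
   positive and that of [x] nonnegative; the energy is thus positive definite along it. *)
pose f (t : R) := (1 - t + t * e) *: one + t *: x.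
have fcont : continuous f.
  move=> t; apply: (@cvgD _ _ _ (nbhs t)); last first.
    by apply: cvgZr_tmp; exact: cvg_id.
  apply: cvgZr_tmp; apply: cvgD.
    by apply: cvgB; [exact: cvg_cst|exact: cvg_id].
  by apply: cvgM; [exact: cvg_id|exact: cvg_cst].
have f0 : f 0 = one by rewrite /f subr0 mul0r addr0 scale0r addr0 scale1r.
have f1 : f 1 = x + e *: one by rewrite /f subrr add0r mul1r scale1r addrC.
have inC : (f @` `[0, 1] `<=` C)%classic.
  apply: connected_component_max.
  - by exists 0; rewrite //= in_itv /= lexx ler01.
  - move=> _ [t /= /itvP t01 <-]; apply/lt0r_neq0/elem_sym_gt0 => V V0.
    rewrite /Etot.
    have -> : f t ord0
        = fun i => (1 - t + t * e) * one ord0 i + t * x ord0 i.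
      by apply/funext => i; rewrite !mxE.
    rewrite energy_comb ltr_pwDl //.
      rewrite mulr_gt0 ?energy_one_gt0 //.
      have [->|t1] := eqVneq t 1; first by rewrite subrr add0r mul1r.
      rewrite ltr_pwDl //; last by rewrite mulr_ge0 ?(ltW e0) ?t01.
      by rewrite subr_gt0 lt_neqAle t1 t01.
    by rewrite mulr_ge0 ?t01 //; exact: Ege0.
  apply: connected_continuous_connected; first exact: segment_connected.
  exact: continuous_subspaceT.
by rewrite -f1; apply: inC; exists 1; rewrite //= in_itv /= lexx ler01.
Qed.

Lemma hyperbolicity_coneE : hyperbolicity_cone (@elem_sym R n j.+1) (const_mx 1)
  = [set x : 'rV[R]_n | forall V, 0 <= Etot x V]%classic.
Proof.
apply/seteqP; split=> [|x Ege0].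
  have cl : closed [set x : 'rV[R]_n | forall V, 0 <= Etot x V]%classic.
    rewrite [X in closed X](_ : _ =
      \bigcap_V [set x : 'rV[R]_n | 0 <= Etot x V])%classic; last first.
      by apply/seteqP; split=> x E V; [move=> _; exact: E|exact: (E V I)].
    apply: closed_bigI => V _.
    by have /continuous_closedP/(_ _ (@closed_ge R 0)) :=
      @energy_continuous R n j.+1 [set: 'I_n] V.
  rewrite /hyperbolicity_cone [X in (_ `<=` X)%classic](closure_id _).1 //.
  apply: closureS => x Cx V; apply: energy_ge0 => //.
    exact: component_esp_all.
  by rewrite cardsT card_ord.
(* Every neighbourhood of [x] meets [C], in a point [x + e *: one] with small [e > 0]. *)
have cvx : ((x + e *: one) @[e --> (0 : R)^'+] --> x + (0 : R) *: one)%classic.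
  apply: cvg_at_right_filter.
  by apply: cvgD; [exact: cvg_cst|apply: cvgZr_tmp; exact: cvg_id].
rewrite scale0r addr0 in cvx; move=> B /cvx Bx.
have [e [Be e0]] : exists e : R, B (x + e *: one) /\ 0 < e.
  near ((0 : R)^'+)%classic => e; exists e.
  split; last by near: e; exact: nbhs_right_gt.
  by near: e; exact: Bx.
by exists (x + e *: one); split=> //; exact: shift_in_component.
Unshelve. all: by end_near. Qed.

End HyperbolicityCone.

Theorem theorem1 (R : realType) (n k : nat) :
  (1 <= n)%N -> (1 <= k)%N -> (k <= n)%N ->
  spectrahedral (hyperbolicity_cone (@elem_sym R n k) (const_mx 1)).
Proof.
case: k => // j _ _ jn; rewrite hyperbolicity_coneE //.
exists _, (@tree_mx R n j.+1); split; first by move=> i; exact: energy_mx_sym.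
split.
  by exists (const_mx 1); apply/pd_tree_pencil => V; exact: energy_one_gt0.
by apply/seteqP; split=> x /psd_tree_pencil.
Qed.
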